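(* Let $h>0$, $a\in\mathbb{R}$, $\nu\in(0,1]$, and let $x,y:(h\mathbb{N})_a\to\mathbb{R}$ satisfy $({}_a\Delta_{h,\ast}^{\nu}x)(t)\ge({}_a\Delta_{h,\ast}^{\nu}y)(t)$ for all $t\in(h\mathbb{N})_{a+(1-\nu)h}$. Then $x(t)-y(t)\ge x(a)-y(a)$ for all $t\in(h\mathbb{N})_a$.
   Context: For $h>0$ and $a\in\mathbb{R}$, $(h\mathbb{N})_a=\{a,a+h,a+2h,\dots\}$, $\sigma(t)=t+h$, and $(\Delta_h y)(t)=\frac{y(t+h)-y(t)}{h}$. The $h$-factorial function is $t_h^{(\alpha)}=h^{\alpha}\frac{\Gamma(t/h+1)}{\Gamma(t/h+1-\alpha)}$, taken to be $0$ when $t/h+1-\alpha$ is a nonpositive integer and $t/h+1$ is not. For $\mu>0$ the fractional $h$-sum is $({}_a\Delta_h^{-\mu}y)(t)=\frac{h}{\Gamma(\mu)}\sum_{s=a/h}^{t/h-\mu}(t-\sigma(sh))_h^{(\mu-1)}y(sh)$ for $t\in(h\mathbb{N})_{a+\mu h}$, where $s$ runs over $a/h,a/h+1,\dots,t/h-\mu$ and $\sigma(sh)=(s+1)h$; and ${}_a\Delta_h^{0}y=y$. For $\nu\in(0,1]$ the Caputo-like fractional $h$-difference is $({}_a\Delta_{h,\ast}^{\nu}y)(t)=({}_a\Delta_h^{-(1-\nu)}(\Delta_h y))(t)$, $t\in(h\mathbb{N})_{a+(1-\nu)h}$ (so it equals $\Delta_h y$ if $\nu=1$). *)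

(* Defs.v *)
From HB Require Import structures.
From mathcomp Require Import all_boot all_order all_algebra.
From mathcomp Require Import all_classical all_reals all_analysis.

Set Implicit Arguments.
Unset Strict Implicit.
Unset Printing Implicit Defensive.

Import Order.TTheory GRing.Theory Num.Theory.
Import numFieldNormedType.Exports.

Local Open Scope classical_set_scope.
Local Open Scope ring_scope.

(* The grid (hN)_a. *)
Definition hN (R : realType) (h a : R) : set R :=
  [set t | exists n : nat, t = a + n%:R * h].

Definition hsigma (R : realType) (h t : R) : R := t + h.

Definition hdiff (R : realType) (h : R) (y : R -> R) (t : R) : R :=
  (y (t + h) - y t) / h.

Definition Euler_integral (R : realType) (x : R) : R :=
  \int[@lebesgue_measure R]_(t in `]0, +oo[) (t `^ (x - 1) * expR (- t)).

(* For x <= 0 the recurrence Gamma (x + 1) = x * Gamma x is iterated n times,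
   n being the least natural number with 0 < x + n. At the poles 0, -1, -2, ...
   the product vanishes and the value is 0. *)
Definition Gamma (R : realType) (x : R) : R :=
  if 0 < x then Euler_integral x
  else let n := (Num.truncn (- x)).+1 in
       Euler_integral (x + n%:R) / \prod_(i < n) (x + i%:R).

Definition nonpos_int (R : realType) (x : R) : bool :=
  (x \is a Num.int) && (x <= 0).

Definition hfactorial (R : realType) (h t alpha : R) : R :=
  if nonpos_int (t / h + 1 - alpha) && ~~ nonpos_int (t / h + 1) then 0
  else h `^ alpha * (Gamma (t / h + 1) / Gamma (t / h + 1 - alpha)).

(* The h-sum of order mu >= 0, relevant for t in (hN)_(a + mu h). The index s
   runs over the reals a/h, a/h + 1, ..., t/h - mu, and the summand uses y at
   the points s * h of (hN)_a only. *)
Definition hsum (R : realType) (h a mu : R) (y : R -> R) (t : R) : R :=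
  if mu == 0 then y t
  else h / Gamma mu *
       \sum_(s \in hN 1 (a / h) `&` [set s | s <= t / h - mu])
          (hfactorial h (t - hsigma h (s * h)) (mu - 1) * y (s * h)).

Definition caputo_hdiff (R : realType) (h a nu : R) (y : R -> R) (t : R) : R :=
  hsum h a (1 - nu) (hdiff h y) t.

(* Main.v *)
Require Import Defs.
From HB Require Import structures.
From mathcomp Require Import all_boot all_order all_algebra.
From mathcomp Require Import all_classical all_reals all_analysis.
From mathcomp Require Import measurable_realfun.
From mathcomp Require Import ring lra.
Import Order.TTheory GRing.Theory Num.Theory.
Import numFieldNormedType.Exports.
Local Open Scope classical_set_scope.
Local Open Scope ring_scope.

(** Write [mu = 1 - nu] and [d = x - y]. For [nu = 1] the hypothesis says that
[d] is nondecreasing along the grid. For [nu < 1], evaluated at the [n]-th point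
of the shifted grid and divided by a positive constant, it reads
  [0 <= \sum_(k <= n) w (n - k) * (d k.+1 - d k)],
where [w j = Gamma (mu + j) / Gamma (j + 1)] are, up to the factor [Gamma mu],
the Taylor coefficients of [(1 - z) ^ (- mu)]. The weights are positive, and
nonincreasing because [w j.+1 / w j = (mu + j) / (j + 1)] and [mu <= 1].

Summation by parts moves the differences from [d] to [w]: with
[e k = d k - d 0] the inequality becomes
  [w 0 * e n.+1 >= \sum_(1 <= k <= n) (w (n - k) - w (n - k + 1)) * e k],
whose coefficients on the right are nonnegative. Strong induction thus gives
[0 <= e n] for all [n] ([ge_origin_of_noninc_convolution]), which is the claim; no
inversion of the fractional sum is involved.

What remains is the ratio of the weights and their sign, that is
[Gamma (x + 1) = x * Gamma x] and [0 < Gamma x] for [0 < x]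
([GammaD1], [Gamma_gt0]). As [Gamma x] is the finite part of an extended real
integral, finiteness has to be shown as well. The functional equation is
proved first, for the extended real integral: integration by parts on the
compact intervals [[1/n, n]], then [n --> oo]. It yields the value [n`!] at
[n + 1], and finiteness everywhere follows by comparison with these
values. *)

(** * Nonnegative convolutions with a nonincreasing sequence *)

(** A discrete maximum principle: after summation by parts,
[w 0 * (d n.+1 - d 0)] dominates a combination of the earlier [d k - d 0] with
the nonnegative coefficients [w (n - k) - w (n - k + 1)]. *)
Lemma ge_origin_of_noninc_convolution (R : realDomainType) (w d : nat -> R)
    (w0_gt0 : 0 < w 0%N) (w_noninc : forall j, w j.+1 <= w j)
    (conv_ge0 : forall n, 0 <= \sum_(k < n.+1) w (n - k)%N * (d k.+1 - d k)) n :
  d 0%N <= d n.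
Proof.
elim/ltn_ind: n => -[//|n] IH.
set e := fun k => d k - d 0%N.
have e0 : e 0%N = 0 by rewrite /e subrr.
have e_ge0 k : (k <= n)%N -> 0 <= e k by move=> kn; rewrite subr_ge0 IH.
have abel : \sum_(k < n.+1) w (n - k)%N * (d k.+1 - d k) =
    w 0%N * e n.+1 - \sum_(k < n) (w (n - k.+1)%N - w (n - k)%N) * e k.+1.
  transitivity (\sum_(k < n.+1) w (n - k)%N * e k.+1 -
                \sum_(k < n.+1) w (n - k)%N * e k).
    by rewrite -sumrB; apply: eq_bigr => k _; rewrite /e; ring.
  rewrite big_ord_recr big_ord_recl /= e0 mulr0 add0r subnn.
  rewrite [X in X - _]addrC -addrA -sumrB -sumrN; congr (_ + _).
  by apply: eq_bigr => k _; rewrite /bump leq0n add1n -mulrBl -mulNr opprB.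
have := conv_ge0 n; rewrite abel subr_ge0 => le_e.
rewrite -subr_ge0 -(pmulr_rge0 _ w0_gt0) (le_trans _ le_e)//.
apply: sumr_ge0 => k _; rewrite mulr_ge0 ?e_ge0// subr_ge0.
by rewrite -(subnSK (ltn_ord k)) w_noninc.
Qed.

(** * Euler's integral *)

Section EulerIntegral.
Context {R : realType}.
Implicit Types (x t a b : R) (n : nat).
Local Notation mu := (@lebesgue_measure R).

Definition gamma_density (x t : R) : R := t `^ (x - 1) * expR (- t).

(** Extended real values let the functional equation be stated, and used,
before the integral is known to converge. *)
Definition gamma_integral (x : R) : \bar R :=
  (\int[mu]_(t in `]0%R, +oo[) (gamma_density x t)%:E)%E.

Lemma gamma_density_ge0 x t : 0 <= gamma_density x t.
Proof. by rewrite mulr_ge0 ?powR_ge0 ?expR_ge0. Qed.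

Lemma measurable_gamma_density (D : set R) x :
  measurable_fun D (fun t => (gamma_density x t)%:E).
Proof.
apply/measurable_EFinP/measurable_funTS.
apply: measurable_funM; first exact: measurable_powR.
by apply: measurableT_comp => //; exact: oppr_measurable.
Qed.

Lemma continuous_powR_gt0 x t : 0 < t -> {for t, continuous (fun s : R => s `^ x)}.
Proof.
move=> t0; apply/differentiable_continuous/derivable1_diffP.
by apply: derivable_powR; rewrite in_itv/= andbT.
Qed.

Lemma within_continuous_gt0 (f : R -> R) a b : 0 < a ->
  (forall t, 0 < t -> {for t, continuous f}) ->
  {within `[a, b], continuous f}.
Proof.
move=> a0 cf; apply: continuous_in_subspaceT => t.
by rewrite inE/= in_itv/= => /andP[/(lt_le_trans a0) t0 _]; exact: cf.
Qed.

Lemma derivable_oo_LRcontinuous_gt0 (f : R -> R) a b : 0 < a -> a < b ->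
  (forall t, 0 < t -> derivable f t 1) -> derivable_oo_LRcontinuous f a b.
Proof.
move=> a0 ab df; have b0 := lt_trans a0 ab.
have cf t : 0 < t -> {for t, continuous f}.
  by move=> t0; apply/differentiable_continuous/derivable1_diffP/df.
split.
- by move=> t; rewrite in_itv/= => /andP[/(lt_trans a0) t0 _]; exact: df.
- by apply: cvg_at_right_filter; exact: cf.
- by apply: cvg_at_left_filter; exact: cf.
Qed.

Lemma is_derive_NexpRN t : is_derive t 1 (fun s : R => - expR (- s)) (expR (- t)).
Proof.
by apply: is_derive_eq; rewrite /GRing.scale/=; ring.
Qed.

Lemma continuous_expRN t : {for t, continuous (fun s : R => expR (- s))}.
Proof.
apply: continuous_comp; first exact: opp_continuous.
exact: continuous_expR.
Qed.

Lemma integral_gamma_density_by_parts x a b : 0 < a -> a < b ->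
  (\int[mu]_(t in `[a, b]) (gamma_density (x + 1) t)%:E =
   (a `^ x * expR (- a) - b `^ x * expR (- b))%:E +
   x%:E * \int[mu]_(t in `[a, b]) (gamma_density x t)%:E)%E.
Proof.
move=> a0 ab.
have cd : {within `[a, b], continuous (fun t => x * t `^ (x - 1))}.
  apply: within_continuous_gt0 => // t t0.
  by apply: cvgM; [exact: cvg_cst|exact: continuous_powR_gt0].
rewrite /gamma_density addrK.
rewrite (@integration_by_parts R (fun s : R => s `^ x) (fun t => - expR (- t))
  (fun t => x * t `^ (x - 1)) (fun t => expR (- t)))//.
- have ig : mu.-integrable `[a, b] (EFin \o gamma_density x).
    apply: continuous_compact_integrable; first exact: segment_compact.
    apply: within_continuous_gt0 => // t t0.
    by apply: cvgM; [exact: continuous_powR_gt0|exact: continuous_expRN].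
  have -> : (\int[mu]_(t in `[a, b]) (x * t `^ (x - 1) * - expR (- t))%:E =
     (- x)%:E * \int[mu]_(t in `[a, b]) (gamma_density x t)%:E)%E.
    rewrite -integralZl//; apply: eq_integral => t _.
    by rewrite -EFinM /gamma_density; congr EFin; ring.
  rewrite EFinN mulNe oppeK; congr (_%:E + _)%E; ring.
- apply: derivable_oo_LRcontinuous_gt0 => // t t0.
  by apply: derivable_powR; rewrite in_itv/= andbT.
- move=> t; rewrite in_itv/= => /andP[/(lt_trans a0) t0 _].
  by rewrite powR_derive1// in_itv/= andbT.
- by apply: within_continuous_gt0 => // t _; exact: continuous_expRN.
- exact: derivable_oo_LRcontinuous_gt0.
- by move=> t _; rewrite derive1E; have [_ ->] := is_derive_NexpRN t.
Qed.

(* The shift by 2 makes the endpoints of every [K n] distinct. *)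
Let K n := `[n.+2%:R^-1, n.+2%:R : R]%classic.

Lemma gamma_integral_lim x :
  (\int[mu]_(t in K n) (gamma_density x t)%:E)%E @[n --> \oo] -->
    gamma_integral x.
Proof.
have -> : gamma_integral x =
    (\int[mu]_(t in \bigcup_n K n) (gamma_density x t)%:E)%E.
  congr integral; apply/seteqP; split=> t /=; last first.
    case=> n _; rewrite /K/= !in_itv/= andbT => /andP[+ _].
    by apply: lt_le_trans; rewrite invr_gt0 ltr0n.
  rewrite in_itv/= andbT => t0.
  exists (Num.truncn t + Num.truncn t^-1)%N => //; rewrite /K/= in_itv/=.
  have lt_tr (s : R) : 0 < s -> s < (Num.truncn s).+1%:R by move=> _; exact: truncnS_gt.
  apply/andP; split.
    rewrite invf_ple ?posrE ?ltr0n// (le_trans (ltW (lt_tr _ _))) ?invr_gt0//.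
    by rewrite ler_nat -addnS -addSn leq_addl.
  by rewrite (le_trans (ltW (lt_tr _ _)))// ler_nat ltnS -addnS leq_addr.
apply: ge0_nondecreasing_set_cvg_integral.
- apply/nondecreasing_seqP => n; apply/subsetPset => t.
  rewrite /K/= !in_itv/= => /andP[nt tn]; apply/andP; split.
    by apply: le_trans nt; rewrite lef_pV2 ?posrE ?ltr0n// ler_nat.
  by apply: le_trans tn _; rewrite ler_nat.
- by move=> n; exact: measurable_itv.
- by move=> n; exact: measurable_gamma_density.
- by move=> n t _; rewrite lee_fin gamma_density_ge0.
Qed.

(** With [N > x], the term [t ^ (N + 1) / (N + 1)!] of the exponential series
bounds [t ^ x * exp (- t)] by [(N + 1)! / t]. *)
Lemma cvg_powR_expRN x : (n.+2%:R `^ x * expR (- n.+2%:R) : R) @[n --> \oo] --> (0 : R).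
Proof.
set N := (Num.truncn x).+1.
apply: (@squeeze_cvgr _ _ _ _ (fun=> 0) (fun n => N.+1`!%:R * n.+1%:R^-1)).
- apply: nearW => n; rewrite mulr_ge0 ?powR_ge0 ?expR_ge0//=.
  set t : R := n.+2%:R.
  have t0 : 0 < t by rewrite ltr0n.
  have tN : t `^ x <= t ^+ N.
    rewrite -(powR_mulrn _ (ltW t0)) ler_powR ?ler1n//.
    exact/ltW/truncnS_gt.
  have et : t ^+ N.+1 / N.+1`!%:R <= expR t.
    by have := expR_ge1Dxn N (ltW t0); apply: le_trans; rewrite lerDr.
  have f0 : (0 : R) < N.+1`!%:R by rewrite ltr0n fact_gt0.
  rewrite expRN ler_pdivrMr ?expR_gt0//.
  apply: (le_trans tN).
  apply: (@le_trans _ _ (N.+1`!%:R * t^-1 * expR t)).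
    rewrite mulrAC ler_pdivlMr// -exprSr mulrC -ler_pdivrMr//.
  apply: ler_wpM2r; first exact: expR_ge0.
  by rewrite ler_pM2l// lef_pV2 ?posrE ?ltr0n// ler_nat.
- exact: cvg_cst.
- rewrite -[X in _ --> X](mulr0 N.+1`!%:R).
  by apply: cvgM; [exact: cvg_cst|exact: cvg_harmonic].
Qed.

Lemma cvg_invn2 : (n.+2%:R^-1 : R) @[n --> \oo] --> (0 : R).
Proof. by have := @cvg_harmonic R; rewrite -(cvg_shiftS (@harmonic R)). Qed.

(** The limit [c] at the left endpoint is left open because it is [1] for
[x = 0] but [0] for [0 < x]. *)
Lemma cvg_boundary x (c : R) : ((n.+2%:R^-1 `^ x : R) @[n --> \oo] --> c) ->
  (n.+2%:R^-1 `^ x * expR (- n.+2%:R^-1) - n.+2%:R `^ x * expR (- n.+2%:R) : R)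
    @[n --> \oo] --> c.
Proof.
move=> cx; rewrite -[X in _ --> X]subr0; apply: cvgB; last exact: cvg_powR_expRN.
rewrite -[X in _ --> X]mulr1; apply: cvgM => //.
rewrite -[X in _ --> X]expR0 -[X in expR X]oppr0.
apply: continuous_cvg; first exact: continuous_expR.
by apply: cvgN; exact: cvg_invn2.
Qed.

Lemma ltr_invn2_n2 n : (n.+2%:R^-1 : R) < n.+2%:R.
Proof. by rewrite (@lt_trans _ _ 1)// ?invf_lt1 ?ltr0n ?ltr1n. Qed.

Let boundary x n : R :=
  n.+2%:R^-1 `^ x * expR (- n.+2%:R^-1) - n.+2%:R `^ x * expR (- n.+2%:R).

Lemma integral_gamma_density_K x n :
  (\int[mu]_(t in K n) (gamma_density (x + 1) t)%:E =
   (boundary x n)%:E + x%:E * \int[mu]_(t in K n) (gamma_density x t)%:E)%E.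
Proof.
by apply: integral_gamma_density_by_parts; rewrite ?ltr_invn2_n2// invr_gt0 ltr0n.
Qed.

(** At [x = 0] the term [x * gamma_integral x], whose integral diverges, has
coefficient zero, and integration by parts leaves only the boundary term. *)
Lemma gamma_integral1 : gamma_integral 1 = 1%E.
Proof.
have E n : (\int[mu]_(t in K n) (gamma_density 1 t)%:E = (boundary 0 n)%:E)%E.
  by have := integral_gamma_density_K 0 n; rewrite add0r mul0e adde0.
have lim1 : (boundary 0 n)%:E @[n --> \oo] --> gamma_integral 1.
  by under eq_fun do rewrite -E; exact: gamma_integral_lim.
apply: (cvg_unique _ lim1) => //.
apply: cvg_EFin; first exact: nearW.
by apply: cvg_boundary; under eq_fun do rewrite powRr0; exact: cvg_cst.
Qed.

Lemma gamma_integralD1 x : 0 < x ->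
  (gamma_integral (x + 1) = x%:E * gamma_integral x)%E.
Proof.
move=> x0.
have limD1 : ((boundary x n)%:E +
    x%:E * \int[mu]_(t in K n) (gamma_density x t)%:E)%E @[n --> \oo] -->
    gamma_integral (x + 1).
  under eq_fun do rewrite -integral_gamma_density_K; exact: gamma_integral_lim.
apply: (cvg_unique _ limD1) => //.
rewrite -[(x%:E * gamma_integral x)%E]add0e; apply: cvgeD => //.
- apply: cvg_EFin; first exact: nearW.
  apply: cvg_boundary.
  have /cvg_at_rightP := powR_cvg0 x0; apply; split; last exact: cvg_invn2.
  by move=> n; rewrite invr_gt0 ltr0n.
- by apply: cvgeZl => //; exact: gamma_integral_lim.
Qed.

Lemma gamma_integral_ge0 x : (0 <= gamma_integral x)%E.
Proof. by apply: integral_ge0 => t _; rewrite lee_fin gamma_density_ge0. Qed.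

Lemma gamma_integral_nat n : gamma_integral n.+1%:R = n`!%:R%:E.
Proof.
elim: n => [|n IH]; first exact: gamma_integral1.
by rewrite -natr1 gamma_integralD1 ?ltr0n// IH -EFinM -natrM factS.
Qed.

(** By the functional equation it suffices to bound the integral at [x + 1],
where the density has no singularity at [0]: it is then at most the sum of the
densities at [1] and at an integer exceeding [x + 1], whose integrals are
factorials. *)
Lemma gamma_integral_lty x : 0 < x -> (gamma_integral x < +oo)%E.
Proof.
move=> x0.
suff : (gamma_integral (x + 1) < +oo)%E.
  rewrite gamma_integralD1//; have := gamma_integral_ge0 x.
  case: gamma_integral => [r _ _||//]; first exact: ltry.
  by rewrite mulry gtr0_sg// mul1e.
set N := (Num.truncn x).+1.
apply: (@le_lt_trans _ _ (gamma_integral 1 + gamma_integral N.+1%:R)%E); last first.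
  by rewrite gamma_integral1 gamma_integral_nat -EFinD ltry.
rewrite -ge0_integralD//=; last 4 first.
- by move=> t _; rewrite lee_fin gamma_density_ge0.
- exact: measurable_gamma_density.
- by move=> t _; rewrite lee_fin gamma_density_ge0.
- exact: measurable_gamma_density.
- apply: ge0_le_integral => //.
  + by move=> t _; rewrite lee_fin gamma_density_ge0.
  + exact: measurable_gamma_density.
  + by apply: emeasurable_funD; exact: measurable_gamma_density.
  + move=> t; rewrite /= in_itv/= andbT => t0.
    rewrite -EFinD lee_fin /gamma_density -mulrDl ler_wpM2r ?expR_ge0//.
    rewrite subrr powRr0 addrK -(natr1 N) addrK.
    have [t1|t1] := leP t 1.
      apply: (@le_trans _ _ 1); last by rewrite lerDl powR_ge0.
      have : t `^ x <= 1 `^ x by rewrite ge0_ler_powR ?nnegrE ?(ltW x0) ?(ltW t0).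
      by rewrite powR1.
    apply: (@le_trans _ _ (t `^ N%:R)); last by rewrite lerDr ler01.
    by rewrite ler_powR ?(ltW t1)//; exact/ltW/truncnS_gt.
Qed.

(** On [[1, 2]], [t ^ (x - 1) >= t ^ (- 1) >= 1 / 2] and
[exp (- t) >= exp (- 2)]. *)
Lemma gamma_integral_gt0 x : 0 < x -> (0 < gamma_integral x)%E.
Proof.
move=> x0.
apply: (@lt_le_trans _ _ (\int[mu]_(t in `[1%R, 2%R]) (expR (- 2) / 2)%:E)%E).
  rewrite integral_cst//= lebesgue_measure_itv/= lte_fin ltr1n/=.
  by rewrite -EFinD -EFinM lte_fin mulr_gt0 ?divr_gt0 ?expR_gt0//; lra.
apply: (@le_trans _ _ (\int[mu]_(t in `[1%R, 2%R]) (gamma_density x t)%:E)%E).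
  apply: ge0_le_integral => //.
    exact: measurable_gamma_density.
  move=> t; rewrite /= in_itv/= => /andP[t1 t2].
  rewrite lee_fin /gamma_density mulrC ler_pM ?expR_ge0 ?invr_ge0 //; last first.
    by rewrite ler_expR lerN2.
  apply: (@le_trans _ _ (t `^ (-1))); last by rewrite ler_powR//; lra.
  have t0 : 0 < (t : R) := lt_le_trans ltr01 t1.
  by rewrite powR_inv1 ?(ltW t0)// lef_pV2 ?posrE.
apply: ge0_subset_integral => //.
- exact: measurable_gamma_density.
- by move=> t _; rewrite lee_fin gamma_density_ge0.
- by move=> t /=; rewrite !in_itv/= andbT => /andP[/(lt_le_trans ltr01)].
Qed.

End EulerIntegral.

(** * The Gamma function and the weights of the fractional sum *)

Section Gamma.
Context {R : realType}.
Implicit Types (x h a mu nu : R) (n j : nat).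

Lemma GammaE x : 0 < x -> (Gamma x)%:E = gamma_integral x.
Proof.
move=> x0; rewrite /Gamma x0 /Euler_integral /Rintegral fineK//.
by rewrite ge0_fin_numE ?gamma_integral_ge0// gamma_integral_lty.
Qed.

Lemma Gamma_gt0 x : 0 < x -> 0 < Gamma x.
Proof. by move=> x0; rewrite -lte_fin GammaE// gamma_integral_gt0. Qed.

Lemma GammaD1 x : 0 < x -> Gamma (x + 1) = x * Gamma x.
Proof.
by move=> x0; apply: EFin_inj; rewrite EFinM !GammaE ?addr_gt0// gamma_integralD1.
Qed.

(** [Gamma mu] times the [j]-th coefficient of [(1 - z) ^ (- mu)]. *)
Definition hsum_weight mu j : R := Gamma (mu + j%:R) / Gamma (j%:R + 1).

Lemma hsum_weight_gt0 mu j : 0 < mu -> 0 < hsum_weight mu j.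
Proof.
by move=> mu0; have j0 := ler0n R j; rewrite divr_gt0 ?Gamma_gt0//; lra.
Qed.

Lemma hsum_weight_noninc mu j : 0 < mu -> mu <= 1 ->
  hsum_weight mu j.+1 <= hsum_weight mu j.
Proof.
move=> mu0 mu1; have j0 := ler0n R j.
have w0 := hsum_weight_gt0 mu j mu0.
have -> : hsum_weight mu j.+1 = (mu + j%:R) / (j%:R + 1) * hsum_weight mu j.
  rewrite /hsum_weight -(natr1 j) addrA (GammaD1 (mu + j%:R)) ?(GammaD1 (j%:R + 1)); [|lra|lra].
  by rewrite invfM mulrACA.
by rewrite ler_piMl ?(ltW w0)// ler_pdivrMr; lra.
Qed.

Lemma hfactorialE h mu j : 0 < h -> 0 < mu ->
  hfactorial h ((mu + j%:R - 1) * h) (mu - 1) = h `^ (mu - 1) * hsum_weight mu j.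
Proof.
move=> h0 mu0; have j0 := ler0n R j; rewrite /hfactorial mulfK ?gt_eqF// subrK.
have -> : mu + j%:R - (mu - 1) = j%:R + 1 by ring.
by rewrite ifF// /nonpos_int leNgt (_ : 0 < j%:R + 1) ?andbF//; lra.
Qed.

(** At the [n]-th point of its domain the fractional sum is, up to a positive
factor, the convolution of the weights with the values of [y] on the grid: the
index [s = a / h + k] contributes the weight of order [n - k]. *)
Lemma hsumE h a mu (y : R -> R) n : 0 < h -> 0 < mu ->
  hsum h a mu y (a + mu * h + n%:R * h) =
  h / Gamma mu * h `^ (mu - 1) *
    \sum_(k < n.+1) hsum_weight mu (n - k)%N * y (a + k%:R * h).
Proof.
move=> h0 mu0; have h_neq0 : h != 0 by rewrite gt_eqF.
rewrite /hsum gt_eqF// -[RHS]mulrA; congr (_ * _); rewrite mulr_sumr.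
have -> : (a + mu * h + n%:R * h) / h - mu = a / h + n%:R by field.
rewrite (reindex_fsbig (fun k => a / h + k%:R) `I_n.+1); last first.
  split.
  - move=> k /= kn; split; first by exists k; rewrite mulr1.
    by rewrite lerD2l ler_nat.
  - by move=> i j _ _ /addrI/eqP; rewrite eqr_nat => /eqP.
  - move=> s /= [[k ->]]; rewrite mulr1 lerD2l ler_nat => kn.
    by exists k.
rewrite -(fsbig_ord _ _ (fun k => hfactorial h (a + mu * h + n%:R * h -
  hsigma h ((a / h + k%:R) * h)) (mu - 1) * y ((a / h + k%:R) * h))).
apply: eq_bigr => k _; have kn : (k <= n)%N by rewrite -ltnS.
have -> : a + mu * h + n%:R * h - hsigma h ((a / h + k%:R) * h) =
    (mu + (n - k)%:R - 1) * h by rewrite natrB// /hsigma; field.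
have -> : (a / h + k%:R) * h = a + k%:R * h by field.
by rewrite hfactorialE// mulrA.
Qed.

End Gamma.

(** * The comparison theorem *)

Theorem lemma3p9 (R : realType) (h a nu : R) (x y : R -> R)
    (h_gt0 : 0 < h) (nu_gt0 : 0 < nu) (nu_le1 : nu <= 1)
    (le_caputo : forall t : R, hN h (a + (1 - nu) * h) t ->
       caputo_hdiff h a nu x t >= caputo_hdiff h a nu y t) :
  forall t : R, hN h a t -> x t - y t >= x a - y a.
Proof.
move=> _ [n ->].
set d := fun k : nat => x (a + k%:R * h) - y (a + k%:R * h).
suff : d 0%N <= d n by rewrite /d mul0r addr0.
have grid m : hN h (a + (1 - nu) * h) (a + (1 - nu) * h + m%:R * h) by exists m.
have succ k : a + k%:R * h + h = a + k.+1%:R * h by rewrite -natr1; ring.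
have [nu1|nu_neq1] := eqVneq nu 1.
  elim: n => // n /le_trans; apply.
  have := le_caputo _ (grid n); rewrite nu1 /caputo_hdiff /hsum subrr eqxx mul0r addr0.
  by rewrite /hdiff ler_pM2r ?invr_gt0// succ /d; lra.
have mu_gt0 : 0 < 1 - nu by rewrite subr_gt0 lt_neqAle nu_neq1.
have mu_le1 : 1 - nu <= 1 by lra.
apply: (@ge_origin_of_noninc_convolution _ (hsum_weight (1 - nu))).
- exact: hsum_weight_gt0.
- by move=> j; exact: hsum_weight_noninc.
- move=> m; have := le_caputo _ (grid m).
  rewrite /caputo_hdiff !hsumE// ler_pM2l; last first.
    by rewrite mulr_gt0 ?powR_gt0// divr_gt0 ?Gamma_gt0.
  rewrite -subr_ge0 -sumrB.
  have -> : \sum_(k < m.+1) hsum_weight (1 - nu) (m - k)%N * (d k.+1 - d k) =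
      h * \sum_(k < m.+1) (hsum_weight (1 - nu) (m - k)%N * hdiff h x (a + k%:R * h)
           - hsum_weight (1 - nu) (m - k)%N * hdiff h y (a + k%:R * h)).
    rewrite mulr_sumr; apply: eq_bigr => k _; rewrite /hdiff !succ /d.
    by field; rewrite gt_eqF.
  by apply: mulr_ge0; exact: ltW.
Qed.
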